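(* Let $G$ be a locally finite periodic group. Then $LC(G)$ is a locally nilpotent subgroup of $G$.
   Context: For a periodic group $G$ (every element has finite order), $o(x)$ denotes the order of $x \in G$. $LCM(G)$ is the set of all $x\in G$ such that $o(x^n z)$ divides $\mathrm{lcm}(o(x^n),o(z))$ for all $z\in G$ and all integers $n$. $LC(G)=\langle LCM(G)\rangle$ is the subgroup of $G$ generated by $LCM(G)$. A group is locally finite (locally nilpotent) if each of its finitely generated subgroups is finite (nilpotent). *)

(* Defs.v *)
From HB Require Import structures.
From mathcomp Require Import all_boot ssrint.
From mathcomp Require Import boolp classical_sets functions cardinality.

Set Implicit Arguments.
Unset Strict Implicit.
Unset Printing Implicit Defensive.

Local Open Scope group_scope.
Local Open Scope classical_set_scope.

Section Groups.
Variable G : groupType.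
Implicit Types (x y z : G) (A H K : set G).

Definition expgz x (n : int) : G :=
  match n with Posz m => x ^+ m | Negz m => x ^- m.+1 end.

Definition finite_order x := exists n : nat, (0 < n)%N && (x ^+ n == 1).

(* The value 0 stands for infinite order; it never occurs in a periodic group. *)
Definition elt_order x : nat :=
  if pselect (finite_order x) is left h then ex_minn h else 0%N.

Definition is_subgroup H : Prop :=
  [/\ H 1, (forall x y, H x -> H y -> H (x * y)) & (forall x, H x -> H x^-1)].

Definition gen_subgroup A : set G := smallest is_subgroup A.

Definition finitely_generated H : Prop :=
  exists2 A : set G, finite_set A & H = gen_subgroup A.

Definition locally (P : set G -> Prop) K : Prop :=
  forall H, is_subgroup H -> H `<=` K -> finitely_generated H -> P H.

Definition comm_subgroup H K : set G :=
  gen_subgroup [set c | exists x y, [/\ H x, K y & c = [~ x, y]]].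

Definition lower_central H (n : nat) : set G :=
  iter n (fun L => comm_subgroup L H) H.

Definition is_nilpotent H : Prop := exists n, lower_central H n = [set 1].

Definition locally_finite K : Prop := locally (@finite_set G) K.

Definition locally_nilpotent K : Prop := locally is_nilpotent K.

End Groups.

Definition periodic (G : groupType) : Prop := forall x : G, finite_order x.

Definition LCM (G : groupType) : set G :=
  [set x | forall (n : int) (z : G),
     elt_order (expgz x n * z) %| lcmn (elt_order (expgz x n)) (elt_order z)].
Arguments LCM : clear implicits.

Definition LC (G : groupType) : set G := gen_subgroup (LCM G).
Arguments LC : clear implicits.

(* Main.v *)
From HB Require Import structures.
Require Import Defs.
From mathcomp Require Import all_boot classical_sets.
From mathcomp Require Import boolp cardinality.
From mathcomp Require Import fingroup cyclic pgroup nilpotent sylow maximal.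
From mathcomp Require ssrint.

Local Open Scope classical_set_scope.

(** In a finite group, let [x] satisfy the lcm condition. Its powers satisfy
    it too, in particular its [p]-part [x_p]. Hence the product of [x_p] with
    any [p]-element [z] is a [p]-element: its order divides the lcm of two
    powers of [p]. The elements of [G] that send [p]-elements to [p]-elements
    by left multiplication form a normal subgroup, and each of them is a
    [p]-element (multiply by [1]); so they all lie in 'O_p(G)
    ([pi_stable_sub_pcore]). Thus [x], a product of its [p]-parts, lies in the
    Fitting subgroup ([lcm_elt_Fitting]), and a finite group generated by such
    elements is nilpotent.

    The locally finite case reduces to this one. A finitely generated [H]
    inside [LC G] involves only finitely many elements of [LCM G]
    ([finitely_generated_sub_gen]); these generate a finite subgroup containing
    [H], and they satisfy the lcm condition there because that condition is
    inherited by subgroups. The finite subgroup is turned into a finite group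
    type ([finsub]), and nilpotency is carried back along the inclusion
    ([nilpotent_sub_finsub]). *)

Section FiniteCore.
Local Open Scope group_scope.
Variables (gT : finGroupType) (G : {group gT}).
Implicit Type pi : nat_pred.

Definition pi_stable pi : {set gT} :=
  [set y in G | [forall z in G, pi.-elt z ==> pi.-elt (y * z)]]%SET.

Lemma pi_stableP pi y :
  reflect (y \in G /\ {in G, forall z, pi.-elt z -> pi.-elt (y * z)})
          (y \in pi_stable pi).
Proof.
rewrite inE; apply: (iffP andP) => -[Gy yP]; split=> //.
  by move=> z Gz; apply/implyP: (forall_inP yP z Gz).
by apply/forall_inP => z Gz; apply/implyP/yP.
Qed.

(** Left multiplications that preserve the set of [pi]-elements compose; by
    finiteness this already gives a group. *)
Lemma pi_stable_group_set pi : group_set (pi_stable pi).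
Proof.
apply/group_setP; split.
  by apply/pi_stableP; split=> // z _; rewrite mul1g.
move=> x y /pi_stableP[Gx xP] /pi_stableP[Gy yP].
apply/pi_stableP; split=> [|z Gz pi_z]; first exact: groupM.
by rewrite -mulgA; apply: xP; [exact: groupM | exact: yP].
Qed.

Canonical pi_stable_group pi := Group (pi_stable_group_set pi).

(** An element [x] of [pi_stable pi] is a [pi]-element because [x * 1] is one,
    and conjugation in [G] permutes the [pi]-elements, which makes the subgroup
    [pi_stable pi] normal. *)
Lemma pi_stable_sub_pcore pi : pi_stable pi \subset 'O_pi(G).
Proof.
apply: pcore_max.
  apply/pgroupP => q q_pr /(Cauchy q_pr)[x /pi_stableP[_ xP] ox].
  have: pi.-elt (x * 1) by apply: xP; rewrite ?group1 // /p_elt order1.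
  by rewrite mulg1 /p_elt ox pnatE.
apply/andP; split; first by apply/fintype.subsetP => x /pi_stableP[].
apply/fintype.subsetP => g Gg; rewrite inE.
apply/fintype.subsetP => _ /imsetP[x xS ->].
case/pi_stableP: xS => Gx xP; apply/pi_stableP; split=> [|z Gz pi_z].
  by rewrite groupJ.
rewrite -[z](conjgKV g) -conjMg p_eltJ; apply: xP; last by rewrite p_eltJ.
by rewrite groupJ ?groupV.
Qed.

(** Each [p]-part of [x] is a power of [x], so the hypothesis puts it in
    [pi_stable p]. *)
Lemma lcm_elt_Fitting x : x \in G ->
  (forall n z, z \in G -> #[x ^+ n * z] %| lcmn #[x ^+ n] #[z]) ->
  x \in 'F(G).
Proof.
move=> Gx xP; rewrite -(prod_constt x); apply: group_prod => p _.
have sOF : 'O_p(G) \subset 'F(G).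
  by apply: Fitting_max (pcore_normal _ _) (pgroup_nil (pcore_pgroup _ _)).
apply: (fintype.subsetP sOF); apply: (fintype.subsetP (pi_stable_sub_pcore p)).
apply/pi_stableP; split=> [|z Gz p_z].
  move: Gx; rewrite -cycle_subG => /fintype.subsetP.
  by apply; exact: cycle_constt.
have [n xpE] := cycleP _ _ (cycle_constt p x).
have := xP n z Gz; rewrite -xpE => o_dvd.
have lcm_dvd : lcmn #[x.`_p] #[z] %| #[x.`_p] * #[z].
  by rewrite dvdn_lcm dvdn_mulr ?dvdn_mull.
apply: pnat_dvd (dvdn_trans o_dvd lcm_dvd) _.
by rewrite pnatM; apply/andP; split; first exact: p_elt_constt.
Qed.

End FiniteCore.

Section Subgroups.
Local Open Scope group_scope.
Variable G : groupType.
Implicit Types (A B H : set G) (x : G).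

Lemma gen_is_subgroup A : is_subgroup (gen_subgroup A).
Proof.
split=> [S [[]]//|x y Ax Ay S SP|x Ax S SP].
  by have [[_ SM _] _] := SP; apply: SM; [exact: Ax | exact: Ay].
by have [[_ _ SV] _] := SP; apply: SV; exact: Ax.
Qed.

Lemma gen_subgroup_min A H :
  is_subgroup H -> A `<=` H -> gen_subgroup A `<=` H.
Proof. exact: smallest_sub. Qed.

Lemma gen_subgroup_mono A B : A `<=` B -> gen_subgroup A `<=` gen_subgroup B.
Proof.
move=> sAB; apply: gen_subgroup_min (gen_is_subgroup B) _.
by move=> x /sAB; exact: sub_gen_smallest.
Qed.

(** The elements obtained from finitely many generators form a subgroup, which
    contains every generator. *)
Lemma gen_subgroup_finitary A x :
  gen_subgroup A x ->
  exists X : set G, [/\ finite_set X, X `<=` A & gen_subgroup X x].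
Proof.
have gen1 (X : set G) : gen_subgroup X 1 by have [] := gen_is_subgroup X.
apply: (@gen_subgroup_min A
  [set x | exists X, [/\ finite_set X, X `<=` A & gen_subgroup X x]]).
  split=> [|a b [X [finX sXA Xa]] [Y [finY sYA Yb]]|a [X [finX sXA Xa]]] /=.
  - by exists set0; split=> //; exact: finite_set0.
  - exists (X `|` Y); split; first by rewrite finite_setU.
      by rewrite subUset.
    have [_ genM _] := gen_is_subgroup (X `|` Y).
    apply: genM; [move: a Xa | move: b Yb]; apply: gen_subgroup_mono.
      exact: subsetUl.
    exact: subsetUr.
  - by exists X; split=> //; have [_ _ genV] := gen_is_subgroup X; exact: genV.
move=> a Aa; exists [set a]; split; first exact: finite_set1.
  by move=> _ ->.
exact: sub_gen_smallest.
Qed.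

Lemma finitely_generated_sub_gen A H :
  finitely_generated H -> H `<=` gen_subgroup A ->
  exists X : set G, [/\ finite_set X, X `<=` A & H `<=` gen_subgroup X].
Proof.
case=> B finB -> sBA.
have /choice[F FP] : forall b : G, exists X : set G, B b ->
    [/\ finite_set X, X `<=` A & gen_subgroup X b].
  move=> b; have [Bb|nBb] := pselect (B b); last by exists set0.
  have [|X XP] := @gen_subgroup_finitary A b; last by exists X.
  by apply: sBA; exact: sub_gen_smallest.
exists (\bigcup_(b in B) F b); split.
- by apply: bigcup_finite => // b /FP[].
- by move=> x [b /FP[_ sFA _] /sFA].
apply: gen_subgroup_min (gen_is_subgroup _) _ => b Bb.
have [_ _ Fb] := FP b Bb; move: b Bb Fb => b Bb.
by apply: gen_subgroup_mono => x Fbx; exists b.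
Qed.

Lemma elt_order_dvdn x n : finite_order x -> (elt_order x %| n) = (x ^+ n == 1).
Proof.
move=> fx; rewrite /elt_order; case: pselect => // h.
case: ex_minnP => m /andP[m_gt0 /eqP xm1] m_min.
rewrite {2}(divn_eq n m) expgnDr mulnC expgnA xm1 expg1n mul1g.
apply/idP/idP => [/eqP -> //|xr1]; apply/eqP/eqP; rewrite -leqn0 leqNgt.
apply/negP => r_gt0; have := m_min (n %% m)%N.
by rewrite r_gt0 xr1 leqNgt ltn_mod m_gt0 => /(_ isT).
Qed.

End Subgroups.

Section FiniteSubgroup.
Local Open Scope group_scope.
Variables (G : groupType) (s : seq G).

(** The proof that [s] lists a subgroup is an argument of the type so that the
    group structure below can be inferred from the type alone. *)
Definition finsub of is_subgroup [set` s] := seq_sub s.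

Hypothesis sG : is_subgroup [set` s].

HB.instance Definition _ := SubFinite.copy (finsub sG) (seq_sub s).

Fact finsub_closed : group_closed [in s].
Proof.
have [s1 sM sV] := sG.
by split=> // x y sx sy; apply: sM => //; exact: sV.
Qed.

HB.instance Definition _ :=
  SubChoice_isSubGroup.Build G [in s] (finsub sG) finsub_closed.

Local Notation fullG := [set: finsub sG]%G.

Lemma valXg (a : finsub sG) n : val (a ^+ n) = val a ^+ n.
Proof. by elim: n => [|n IHn]; rewrite ?expg0 ?val1 // !expgS valM IHn. Qed.

Lemma valVg (a : finsub sG) : val a^-1 = (val a)^-1.
Proof. by apply: (mulgI (val a)); rewrite -valM !mulgV val1. Qed.

Lemma valRg (a b : finsub sG) : val [~ a, b] = [~ val a, val b].
Proof. by rewrite /commg /conjg !valM !valVg. Qed.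

Lemma elt_order_val (a : finsub sG) : elt_order (val a) = #[a].
Proof.
have vX n : (val a ^+ n == 1) = (a ^+ n == 1).
  by rewrite -valXg -(val1 (finsub sG)) (inj_eq val_inj).
have fa : finite_order (val a).
  by exists #[a]; rewrite order_gt0 vX expg_order eqxx.
apply/eqP; rewrite eqn_dvd elt_order_dvdn // vX expg_order eqxx /=.
by rewrite order_dvdn -vX -elt_order_dvdn.
Qed.

Lemma image_group_is_subgroup (L : {group finsub sG}) :
  is_subgroup (val @` [set` L]).
Proof.
split=> [|_ _ [a La <-] [b Lb <-]|_ [a La <-]].
- by exists 1; [exact: group1 | exact: val1].
- by exists (a * b); [exact: groupM | exact: valM].
- by exists a^-1; [rewrite /= groupV | exact: valVg].
Qed.

(** Stated as an inclusion, so that the lower central series of [H] can be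
    bounded by that of the whole finite group, which dispenses with making [H]
    a group of its own inside [finsub sG]. *)
Lemma lower_central_sub (H : set G) n : H `<=` [set` s] ->
  lower_central H n `<=` val @` [set` 'L_n.+1(fullG)].
Proof.
move=> sHs.
have liftH y : H y -> exists b : finsub sG, val b = y.
  by move=> /sHs sy; exists (Sub y sy); exact: SubK.
elim: n => [|n IHn] /=.
  by move=> y /liftH[b <-]; exists b => //=; rewrite lcn1 finset.in_setT.
apply: gen_subgroup_min; first exact: image_group_is_subgroup.
move=> _ [_ [_ [/IHn[a La <-] /liftH[b <-] ->]]].
exists [~ a, b]; last exact: valRg.
exact: mem_commg La (finset.in_setT b).
Qed.

Lemma nilpotent_sub_finsub (H : set G) :
  nilpotent fullG -> is_subgroup H -> H `<=` [set` s] ->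
  is_nilpotent H.
Proof.
move=> /lcnP[n Ln1] [H1 _ _] sHs; exists n.
apply/seteqP; split=> [x /(lower_central_sub _ n sHs)[a]|_ ->].
  rewrite Ln1 => /set1P-> <-; exact: val1.
by case: n {Ln1} => [//|n]; have [] := gen_is_subgroup _
  [set c | exists x y, [/\ lower_central H n x, H y & c = [~ x, y]]].
Qed.

(** The lcm condition in [G] implies the one in the subgroup listed by [s],
    since orders do not change, so the generators fall in the Fitting
    subgroup. *)
Lemma nilpotent_finsub (X : set G) :
  [set` s] = gen_subgroup X -> X `<=` LCM G -> nilpotent fullG.
Proof.
move=> sE XLCM.
have XF x : X x ->
    exists2 a : finsub sG, val a = x & a \in 'F(fullG).
  move=> Xx; have sx : x \in s.
    by change ([set` s] x); rewrite sE; exact: sub_gen_smallest.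
  pose a : finsub sG := Sub x sx; have aE : val a = x by exact: SubK.
  exists a => //; apply: lcm_elt_Fitting => [|n z _]; first exact: finset.in_setT.
  by rewrite -!elt_order_val valM valXg aE; exact: (XLCM x Xx (ssrint.Posz n)).
apply: (@nilpotentS _ 'F(fullG)); last exact: Fitting_nil.
apply/fintype.subsetP => a _.
have : gen_subgroup X (val a) by rewrite -sE; exact: (valP a).
case/(gen_subgroup_min _ _ _ (image_group_is_subgroup 'F(fullG)%G)).
  by move=> x /XF[b <- bF]; exists b.
by move=> b bF /val_inj <-.
Qed.

End FiniteSubgroup.

Theorem theorem1p1 (G : groupType) (perG : periodic G)
    (lfG : locally_finite [set: G]) :
  is_subgroup (LC G) /\ locally_nilpotent (LC G).
Proof.
split; first exact: gen_is_subgroup.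
move=> H subH HLC fgH.
have [X [finX XLCM HX]] := finitely_generated_sub_gen _ _ _ fgH HLC.
have /finite_seqP[s sE] : finite_set (gen_subgroup X).
  apply: lfG => //; first exact: gen_is_subgroup.
  by exists X.
have sG : is_subgroup [set` s] by rewrite -sE; exact: gen_is_subgroup.
apply: (nilpotent_sub_finsub _ _ sG) => //; last by rewrite -sE.
exact: nilpotent_finsub _ _ _ _ (esym sE) XLCM.
Qed.
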